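(* Let $\bar{\mathcal{K}}$ be the closed CW complex obtained from the triangulation $\mathcal{K}$ by collapsing each boundary component to a point, let $T$, $\tilde T$, $E_M$, $f$ and $\iota^M(f,e)$ be as defined in the context, and let $E_M=E_M^{\mathrm{I}}\sqcup E_M^{\mathrm{II}}$, where $E_M^{\mathrm{I}}$ is the set of $e\in E_M$ with $\iota^M(f,e)=0$ and $E_M^{\mathrm{II}}$ the set of $e\in E_M$ with $\iota^M(f,e)=2\eta_e$, $\eta_e\in\{-1,+1\}$. For each $e\in E_M$ let $c_e$ be the unique cycle in the graph $T\cup\{e\}$, oriented according to the orientation of $e$ and regarded as a $1$-cycle of $\bar{\mathcal{K}}$. Let $g:=|E_M|=2-\chi$, where $\chi$ is the Euler characteristic of $\bar{\mathcal{K}}$. Then: (i) If $|E_M^{\mathrm{II}}|=0$, then $H_1(\bar{\mathcal{K}};\mathbb{Z})\cong\mathbb{Z}^g$. (ii) If $|E_M^{\mathrm{II}}|>0$, then $H_1(\bar{\mathcal{K}};\mathbb{Z})\cong\mathbb{Z}^{g-1}\oplus\mathbb{Z}/2\mathbb{Z}$. In this case, the torsion generator (the generator of the torsion subgroup $\mathbb{Z}/2\mathbb{Z}$) is represented by $$\bar c^{\,*}:=\sum_{e\in E_M^{\mathrm{II}}}\eta_e\,c_e .$$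
   Context: $\Gamma\subset\mathbb{R}^3$ is a compact connected $2$-manifold with (possibly empty) boundary, possibly non-orientable; $\mathcal{K}=(V,E,F)$ is a triangulation of $\Gamma$ (a regular CW complex whose cells are simplices), each cell with a fixed orientation; $\iota(x,x')$ are the incidence numbers; $\partial\mathcal{K}$ is the subcomplex induced on $\partial\Gamma$, with connected components $\partial\mathcal{K}_1,\dots,\partial\mathcal{K}_{N^{\mathrm{ho}}}$. **$\bar{\mathcal{K}}$.** For each $k$, a closed disk $D_k$ is glued along $\partial\mathcal{K}_k$ and contracted to a single $0$-cell $n_k$. Accordingly the CW structure of $\bar{\mathcal{K}}$ is obtained from that of $\mathcal{K}$ by removing every $1$-cell of $\partial\mathcal{K}$ and identifying all $0$-cells of $\partial\mathcal{K}_k$ with $n_k$, for each $k$; the $2$-cells are those of $\mathcal{K}$. **Dual graph.** Each face $f'$ has a dual node $D(f')$; $\tilde V=D(F)$. Each internal edge $e$, shared by two faces, has dual edge $D(e)$ joining their dual nodes. Each boundary edge $e$, contained in the unique face $f_e$, has an additional boundary dual node $D_\partial(e)$ and dual edge $D(e)=\{D(f_e),D_\partial(e)\}$. $\tilde G=(\tilde V,\tilde E)$ with $\tilde E=D(E)$. **Trees and $E_M$.** Choose a spanning tree on each connected component of $\partial\mathcal{K}$ and extend their union to a spanning tree $T=(V_T,E_T)$ of the $1$-skeleton of $\mathcal{K}$. Choose a spanning tree $\tilde T$ of $(\tilde V,\tilde E\setminus D(E_T))$; for each $k$ take the unique edge $e$ of $\partial\mathcal{K}_k$ not in $E_T$ and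 add $D(e)$ and $D_\partial(e)$ to $\tilde T$. $E_M:=\{e\in E:e\notin E_T,\ D(e)\text{ is not an edge of }\tilde T\}$. $T$ and $\tilde T$ induce spanning trees of $\bar{\mathcal{K}}$ and of the dual graph of $\bar{\mathcal{K}}$, denoted by the same symbols. **Morse incidence numbers.** $T$ and $\tilde T$ induce an acyclic matching $M$ on $\bar{\mathcal{K}}$ (rooted trees: every non-root vertex of $T$ is matched with the tree edge towards the root; every non-root face is matched with the edge dual to the $\tilde T$-edge towards the root), with one critical $0$-cell, critical $1$-cells $E_M$, and one critical $2$-cell $f$ (the root of $\tilde T$, chosen arbitrarily). By discrete Morse theory $\bar{\mathcal{K}}$ is homotopy equivalent to a CW complex $\bar{\mathcal{K}}_M$ with these cells, whose boundary map is $\partial_2^M f=\sum_{e\in E_M}\iota^M(f,e)\,e$, where $\iota^M(f,e)$ is computed as follows. For a face $f'$ let $f=x_0,x_1,\dots,x_l=f'$ be the faces along the unique path in $\tilde T$ from $D(f)$ to $D(f')$ and let $d(x_i)$ be the edge whose dual joins $D(x_{i-1})$ and $D(x_i)$; put $\xi_0=1$, $\xi_i=-\xi_{i-1}\,\iota(x_{i-1},d(x_i))/\iota(x_i,d(x_i))$ and $\xi_{f'}:=\xi_l$. Then $\iota^M(f,e)=\sum_{f'}\xi_{f'}\,\iota(f',e)$, the sum being over the two faces $f'$ incident on $e$. Each $\iota^M(f,e)$ is $0$ or $\pm2$. *)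

(* Defs.v *)
(* Mathematical Components, with mathcomp.classical.boolp for the (classical)
   membership predicate of the group of boundaries. *)
From HB Require Import structures.
From mathcomp Require Import all_boot all_order all_algebra.
From mathcomp Require Import generic_quotient ring_quotient boolp.

Set Implicit Arguments.
Unset Strict Implicit.
Unset Printing Implicit Defensive.

Import GRing.Theory.
Local Open Scope ring_scope.

(* Finite 2-dimensional CW complexes, each cell with a fixed orientation, given
   by their cells and incidence numbers [inc1 e v = iota(e,v)] and
   [inc2 f e = iota(f,e)].  All 0-cells are positively oriented, so that the
   incidence numbers of a 1-cell add up to 0. *)
Record cwcomplex := CWComplex {
  cell0 : finType;
  cell1 : finType;
  cell2 : finType;
  inc1 : cell1 -> cell0 -> int;
  inc2 : cell2 -> cell1 -> int;
  inc_augmentation : forall e, \sum_(v : cell0) inc1 e v = 0;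
  inc_diamond : forall f v, \sum_(e : cell1) inc2 f e * inc1 e v = 0
}.

Section CellularHomology.
Variable X : cwcomplex.

Definition chain0 := {ffun cell0 X -> int}.
Definition chain1 := {ffun cell1 X -> int}.
Definition chain2 := {ffun cell2 X -> int}.

Definition bd1 (c : chain1) : chain0 := [ffun v => \sum_e c e * inc1 e v].
Definition bd2 (c : chain2) : chain1 := [ffun e => \sum_f c f * inc2 f e].

Fact bd1_is_zmod_morphism : zmod_morphism bd1.
Proof.
move=> c c'; apply/ffunP => v; rewrite !ffunE -sumrB.
by apply: eq_bigr => e _; rewrite !ffunE mulrBl.
Qed.
HB.instance Definition _ := GRing.isZmodMorphism.Build _ _ bd1 bd1_is_zmod_morphism.

Fact bd2_is_zmod_morphism : zmod_morphism bd2.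
Proof.
move=> c c'; apply/ffunP => v; rewrite !ffunE -sumrB.
by apply: eq_bigr => e _; rewrite !ffunE mulrBl.
Qed.
HB.instance Definition _ := GRing.isZmodMorphism.Build _ _ bd2 bd2_is_zmod_morphism.

Lemma bd1_bd2 c : bd1 (bd2 c) = 0.
Proof.
apply/ffunP => v; rewrite !ffunE.
under eq_bigr => e _ do rewrite ffunE mulr_suml.
rewrite exchange_big big1 // => f _ /=.
by under eq_bigr => e _ do rewrite -mulrA; rewrite -mulr_sumr inc_diamond mulr0.
Qed.

Definition is_cycle1 : pred chain1 := fun c => bd1 c == 0.

Fact is_cycle1_zmod_closed : zmod_closed is_cycle1.
Proof.
split=> [|c c'].
  by rewrite unfold_in /is_cycle1 raddf0.
rewrite !unfold_in /is_cycle1 => /eqP dc /eqP dc'.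
by rewrite raddfB /= dc dc' subrr.
Qed.
HB.instance Definition _ :=
  GRing.isZmodClosed.Build chain1 is_cycle1 is_cycle1_zmod_closed.

Record cycle1 := Cycle1 { cycle1_val :> chain1; _ : is_cycle1 cycle1_val }.
HB.instance Definition _ := [isSub for cycle1_val].
HB.instance Definition _ := [Choice of cycle1 by <:].
HB.instance Definition _ := [SubChoice_isSubZmodule of cycle1 by <:].

Definition is_boundary1 : pred cycle1 :=
  fun z => `[< exists b : chain2, bd2 b = z >].

Fact is_boundary1_zmod_closed : zmod_closed is_boundary1.
Proof.
split=> [|z z'].
  by rewrite unfold_in; apply/asboolP; exists 0; rewrite raddf0.
rewrite !unfold_in => /asboolP[b bz] /asboolP[b' bz']; apply/asboolP; exists (b - b').
by rewrite raddfB /= bz bz'.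
Qed.
HB.instance Definition _ :=
  GRing.isZmodClosed.Build cycle1 is_boundary1 is_boundary1_zmod_closed.

Definition boundaries1 : zmodClosed cycle1 :=
  GRing.ZmodClosed.clone cycle1 is_boundary1 _.

Definition H1 : zmodType := Quotient.quot boundaries1.

Definition hclass (z : cycle1) : H1 := (\pi_(Quotient.quot boundaries1) z)%qT.

Definition euler_char : int := #|cell0 X|%:Z - #|cell1 X|%:Z + #|cell2 X|%:Z.

End CellularHomology.

Definition zmod_isomorphic (A B : zmodType) : Prop :=
  exists phi : {additive A -> B}, bijective phi.

Definition is_torsion (A : zmodType) (x : A) : Prop :=
  exists2 n : nat, (0 < n)%N & x *+ n = 0.

Definition generates_torsion (A : zmodType) (t : A) : Prop :=
  forall x : A, is_torsion x <-> exists k : int, x = t *~ k.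

(* Finite multigraphs with nodes [N] and edges [A]; [ends a x] means that [x]
   is an end of [a].  A walk from [x] is the sequence of its (edge, next node)
   pairs. *)
Section Multigraph.
Variables (N A : finType) (ends : A -> N -> bool).
Implicit Types (B : {set A}) (S : {set N}) (x y : N) (p : seq (A * N)).

Fixpoint walk B x p : bool :=
  if p is (a, y) :: p' then
    [&& a \in B, ends a x, ends a y, x != y & walk B y p']
  else true.

Definition walk_end x p : N := last x (unzip2 p).

Definition simple_path B x y p : bool :=
  [&& walk B x p, walk_end x p == y & uniq (x :: unzip2 p)].

Definition circuit B x p : bool :=
  [&& p != [::], walk B x p, walk_end x p == x,
      uniq (unzip2 p) & uniq (unzip1 p)].

Definition spanning_tree S (E B : {set A}) : Prop :=
  [/\ B \subset E,
      (forall a x, a \in B -> ends a x -> x \in S),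
      (forall x y, x \in S -> y \in S -> exists p, simple_path B x y p)
    & (forall x p, ~~ circuit B x p)].

End Multigraph.

Section Surface.
Variable K : cwcomplex.
Implicit Types (e : cell1 K) (v : cell0 K) (f : cell2 K).

Definition is_end e v : bool := inc1 e v != 0.
Definition is_side e f : bool := inc2 f e != 0.

(* The number of faces containing [e]. *)
Definition nb_faces e : nat := #|[set f | is_side e f]|.

(* Since the incidence numbers of a face with its three edges are [+-1],
   [inc_diamond] and parity force every vertex on one of these edges to lie on
   exactly two of them: the boundary of a face is a triangle. *)
Definition simplicial_cells : Prop :=
  [/\ (forall e v, inc1 e v \in [:: -1; 0; 1]),
      (forall e, #|[set v | is_end e v]| = 2%N),
      (forall f e, inc2 f e \in [:: -1; 0; 1])
    & (forall f, #|[set e | is_side e f]| = 3%N)].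

Definition adjacent v w : bool := [exists e, is_end e v && is_end e w].

(* The link of [v] is the multigraph whose nodes are the edges at [v] and whose
   edges are the faces at [v]; [link_adj v] is its adjacency relation. *)
Definition link_adj v e e' : bool :=
  [&& is_end e v, is_end e' v & [exists f, is_side e f && is_side e' f]].

(* [K] triangulates a nonempty compact connected surface, with or without
   boundary, orientable or not: all vertex links are connected with all degrees
   1 or 2, that is, arcs or circles. *)
Definition triangulated_surface : Prop :=
  [/\ simplicial_cells,
      (exists f : cell2 K, True),
      (forall v w, connect adjacent v w),
      (forall e, nb_faces e \in [:: 1; 2]%N)
    & (forall v, (exists e, is_end e v) /\
       forall e e', is_end e v -> is_end e' v -> connect (link_adj v) e e')].

Definition bdE : {set cell1 K} := [set e | nb_faces e == 1%N].

Definition bd_adjacent v w : bool :=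
  [exists e in bdE, is_end e v && is_end e w].

(* The vertex set of the component of [v] in the boundary subcomplex, or the
   singleton of [v] when [v] is an interior vertex. *)
Definition bd_comp v : {set cell0 K} := [set w | connect bd_adjacent v w].

Definition bd_comp_edges v : {set cell1 K} :=
  [set e in bdE | [forall w, is_end e w ==> (w \in bd_comp v)]].

Definition boundary_spanning_trees (TB : {set cell1 K}) : Prop :=
  TB \subset bdE /\
  forall e v, e \in bdE -> is_end e v ->
    spanning_tree is_end (bd_comp v) (bd_comp_edges v) (TB :&: bd_comp_edges v).

End Surface.

Section Collapse.
Variable K : cwcomplex.

Definition cell0bar : finType :=
  {C : {set cell0 K} | C \in [set bd_comp v | v : cell0 K]}.
Definition cell1bar : finType := {e : cell1 K | e \notin bdE K}.

(* The 0-cells of an edge may become identified, its incidence numbers then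
   add up. *)
Definition inc1bar (e : cell1bar) (n : cell0bar) : int :=
  \sum_(v in \val n) inc1 (\val e) v.
Definition inc2bar (f : cell2 K) (e : cell1bar) : int := inc2 f (\val e).

Lemma bd_comp_eq (v w : cell0 K) : (w \in bd_comp v) = (bd_comp w == bd_comp v).
Proof.
have sym : connect_sym (@bd_adjacent K).
  apply: sym_connect_sym => x y; apply: eq_existsb => e.
  by rewrite [is_end e x && _]andbC.
apply/idP/eqP => [|<-]; last by rewrite inE connect0.
rewrite inE => vw; apply/setP => u; rewrite !inE.
by apply/esym; apply: same_connect.
Qed.

Definition to0bar (v : cell0 K) : cell0bar := exist _ (bd_comp v) (imset_f _ isT).

Lemma to0barE (v : cell0 K) (n : cell0bar) : (v \in \val n) = (to0bar v == n).
Proof.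
by case: n => C CP; have /imsetP[w _ Cw] := CP; rewrite -val_eqE /= Cw bd_comp_eq.
Qed.

Fact inc1bar_augmentation e : \sum_(n : cell0bar) inc1bar e n = 0.
Proof.
rewrite -[RHS](inc_augmentation (\val e)) (partition_big to0bar xpredT) //=.
by apply: eq_bigr => n _; apply: eq_bigl => v; rewrite to0barE.
Qed.

Lemma inc1_bdE (e : cell1 K) (n : cell0bar) :
  e \in bdE K -> \sum_(v in \val n) inc1 e v = 0.
Proof.
move=> eb.
have ends v w : is_end e v -> is_end e w -> bd_comp v = bd_comp w.
  move=> ev ew; apply/eqP; rewrite -bd_comp_eq inE connect1 //.
  by apply/exists_inP; exists e; rewrite // ev ew.
case: (pickP [pred v | (v \in \val n) && is_end e v]) => [v0|none]; last first.
  apply: big1 => v vn; have /negbT := none v.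
  by rewrite /= vn /= negbK => /eqP.
case/andP=> v0n ev0; rewrite -[RHS](inc_augmentation e).
rewrite [RHS](bigID (mem (\val n))) /= [X in _ = _ + X]big1 ?addr0 // => v vn.
apply/eqP/negPn; apply: contra vn => ev.
move: v0n; rewrite !to0barE => /eqP <-.
by rewrite -val_eqE /= (ends v v0).
Qed.

Fact collapse_diamond f n :
  \sum_(e : cell1bar) inc2bar f e * inc1bar e n = 0.
Proof.
have -> : \sum_(e : cell1bar) inc2bar f e * inc1bar e n =
          \sum_(e | e \notin bdE K) inc2 f e * \sum_(v in \val n) inc1 e v.
  by rewrite [RHS]big_sub.
have -> : \sum_(e | e \notin bdE K) inc2 f e * \sum_(v in \val n) inc1 e v =
          \sum_e inc2 f e * \sum_(v in \val n) inc1 e v.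
  rewrite [RHS](bigID (mem (bdE K))) /= [X in _ = X + _]big1 ?add0r // => e eb.
  by rewrite inc1_bdE ?mulr0.
under eq_bigr => e _ do rewrite mulr_sumr.
by rewrite exchange_big big1 // => v _; apply: inc_diamond.
Qed.

(* Each boundary component is collapsed to a point: the boundary edges
   disappear and the vertices of a boundary component become one 0-cell. *)
Definition collapse : cwcomplex :=
  CWComplex inc1bar_augmentation collapse_diamond.

End Collapse.

Section TreeCotree.
Variable K : cwcomplex.
Implicit Types (e : cell1 K) (v : cell0 K) (f : cell2 K).
Implicit Types (T Tc Td : {set cell1 K}).

(* The dual graph has the faces as nodes; a dual edge [D(e)] is represented by
   [e].  The dual edge of a boundary edge joins no two faces, so a spanning
   tree on the dual nodes of the faces uses dual edges of interior edges. *)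
Definition dual_spanning_tree T Tc : Prop :=
  spanning_tree (@is_side K) [set: cell2 K] (~: T :\: bdE K) Tc.

(* Each boundary edge outside [T] is added together with its boundary dual node,
   a leaf that needs no representation. *)
Definition extended_dual_tree T Tc : {set cell1 K} := Tc :|: (bdE K :\: T).

Definition EM T Td : {set cell1 K} := [set e | (e \notin T) && (e \notin Td)].

(* [transport a x p] is the coefficient obtained from the coefficient [a] of
   the face [x] at the end of the walk [p] from [x]; the denominators are
   [+-1], which are units of [int]. *)
Fixpoint transport (a : int) (x : cell2 K) (p : seq (cell1 K * cell2 K)) : int :=
  if p is (d, y) :: p' then transport (- (a * inc2 x d / inc2 y d)) y p' else a.

(* A simple path has at most [#|cell2 K|] steps, so the bound on its length is
   harmless. *)
Definition xi Td f f' : int :=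
  if [pick p : {bseq #|cell2 K| of cell1 K * cell2 K}
      | simple_path (@is_side K) Td f f' p] is Some p
  then transport 1 f p else 0.

Definition morse_inc Td f e : int :=
  \sum_(f' | is_side e f') xi Td f f' * inc2 f' e.

Definition EM_I T Td f : {set cell1 K} :=
  [set e in EM T Td | morse_inc Td f e == 0].
Definition EM_II T Td f : {set cell1 K} :=
  [set e in EM T Td | (morse_inc Td f e == 2) || (morse_inc Td f e == - 2)].

Definition eta Td f e : int := if morse_inc Td f e == 2 then 1 else - 1.

(* The last component of a step [(a, y)] is the node it arrives at, so the step
   runs along the orientation of [a] when [inc1 a y = 1]. *)
Definition walk_chain (p : seq (cell1 K * cell0 K)) : chain1 K :=
  [ffun a => \sum_(s <- p | s.1 == a) inc1 a s.2].

(* The cycle of [T + e] is listed from the initial vertex of [e], with [e] as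
   first step. *)
Definition tree_cycle T e : chain1 K :=
  if [pick q : cell0 K * {bseq #|cell0 K| of cell1 K * cell0 K}
      | [&& circuit (@is_end K) (e |: T) q.1 q.2,
            inc1 e q.1 == - 1 & ohead (unzip1 q.2) == Some e]] is Some q
  then walk_chain q.2 else 0.

(* The image in the collapsed complex of a chain of [K]. *)
Definition chain_bar (c : chain1 K) : chain1 (collapse K) :=
  [ffun e => c (\val e)].

Definition cstar T Td f : chain1 (collapse K) :=
  \sum_(e in EM_II T Td f) chain_bar (tree_cycle T e) *~ eta Td f e.

End TreeCotree.

(* Main.v *)
(* Paths in the trees TB on the boundary components map to points, so every
   1-cycle of the collapsed complex lifts to a 1-cycle of K that vanishes on the
   boundary edges outside T, hence is determined by its values on the edges
   outside T; these values are arbitrary because of the cycles c_e.  The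
   boundaries of 2-chains take arbitrary values on the cotree Tc, and a 2-chain
   whose boundary vanishes on Tc is a multiple of the chain with coefficients
   xi.  Eliminating the edges of Tc identifies H_1 with the quotient of Z^(E_M)
   by the single relation (iota^M(f,e))_e, whose entries are 0 or +-2; half of
   this vector represents cstar. *)
Require Import Defs.
From HB Require Import structures.
From mathcomp Require Import all_boot all_order all_algebra.
From mathcomp Require Import generic_quotient ring_quotient ring zify.

Set Implicit Arguments.
Unset Strict Implicit.
Unset Printing Implicit Defensive.

Import GRing.Theory.
Local Open Scope ring_scope.

(** * Forests in multigraphs *)

Section Forest.
Variables (N A : finType) (ends : A -> N -> bool).
Implicit Types (B : {set A}) (a : A) (x y : N) (p : seq (A * N)).

(** Required only on a set of edges: the dual edge of a boundary edge meets a single face. *)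
Definition two_ended B := {in B, forall a, #|[set x | ends a x]| = 2%N}.

Definition acyclic B := forall x p, ~~ circuit ends B x p.

Lemma two_ended_sub B B' : B' \subset B -> two_ended B -> two_ended B'.
Proof. by move=> sB tB a /(subsetP sB); apply: tB. Qed.

Lemma two_endedE B a x y :
    two_ended B -> a \in B -> ends a x -> ends a y -> x != y ->
  forall z, ends a z = (z == x) || (z == y).
Proof.
move=> tB aB ax ay xy z.
suff /eqP/setP/(_ z) : [set x; y] == [set z | ends a z] by rewrite !inE => <-.
rewrite eqEcard tB // cards2 xy andbT.
by apply/subsetP => w; rewrite !inE => /orP[] /eqP->.
Qed.

Lemma other_end B a x :
  two_ended B -> a \in B -> ends a x -> exists2 y, ends a y & x != y.
Proof.
move=> tB aB ax; have := cardsD1 x [set x | ends a x].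
rewrite tB // inE ax => -[/esym c1].
have /card_gt0P[y] : (0 < #|[set x | ends a x] :\ x|)%N by rewrite -c1.
by rewrite !inE eq_sym => /andP[xy ay]; exists y.
Qed.

Lemma sum_two_ends (V : nmodType) B a x y (F : N -> V) :
    two_ended B -> a \in B -> ends a x -> ends a y -> x != y ->
    (forall z, ~~ ends a z -> F z = 0) ->
  \sum_z F z = F x + F y.
Proof.
move=> tB aB ax ay xy F0.
rewrite (bigD1 x) // (bigD1 y) 1?eq_sym //= big1 ?addr0 // => z /andP[zx zy].
by rewrite F0 // (two_endedE tB aB ax ay xy) negb_or zx.
Qed.

Lemma walk_sub B B' x p : B' \subset B -> walk ends B' x p -> walk ends B x p.
Proof.
move=> sB; elim: p x => //= -[a y] p IHp x /and5P[aB -> -> -> /IHp->].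
by rewrite (subsetP sB).
Qed.

Lemma walk_cat B x p q :
  walk ends B x (p ++ q) = walk ends B x p && walk ends B (walk_end x p) q.
Proof. by elim: p x => //= -[a y] p IHp x; rewrite IHp /walk_end /= -!andbA. Qed.

Lemma walk_edges B x p : walk ends B x p -> {subset unzip1 p <= B}.
Proof.
elim: p x => //= -[a y] p IHp x /and5P[aB _ _ _ /IHp sp] b.
by rewrite inE => /orP[/eqP->|/sp].
Qed.

Lemma walk_invariant (P : N -> Prop) B x p :
    (forall a y z, a \in B -> ends a y -> ends a z -> y != z -> P y -> P z) ->
  walk ends B x p -> P x -> P (walk_end x p).
Proof.
move=> stepP; elim: p x => //= -[a y] p IHp x /and5P[aB ax ay xy wp] Px.
by apply: IHp wp (stepP a x y _ _ _ _ Px).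
Qed.

(** The two ends of an edge of a walk are exactly the nodes before and after it, so an edge at [x]
    would put [x] on the walk. *)
Lemma walk_avoid B x y p :
    two_ended B -> walk ends B y p -> x \notin y :: unzip2 p ->
  {in unzip1 p, forall b, ~~ ends b x}.
Proof.
move=> tB; elim: p y => //= -[a z] p IHp y /and5P[aB ay az yz wp].
rewrite inE negb_or => /andP[xy xzp] b /predU1P[->|]; last exact: IHp wp xzp b.
move: xzp; rewrite inE negb_or => /andP[xz _].
by rewrite (two_endedE tB aB ay az yz) negb_or xy.
Qed.

Lemma simple_walk_uniq_edges B x p :
  two_ended B -> walk ends B x p -> uniq (x :: unzip2 p) -> uniq (unzip1 p).
Proof.
move=> tB; elim: p x => //= -[a y] p IHp x /and5P[aB ax _ _ wp] /andP[xp up].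
rewrite (IHp y) // andbT; apply: contraL ax.
exact: (walk_avoid tB wp xp).
Qed.

Lemma acyclic_sub B B' : B' \subset B -> acyclic B -> acyclic B'.
Proof.
move=> sB aB x p; apply: contra (aB x p) => /and5P[? w ? ? ?].
by apply/and5P; split=> //; apply: walk_sub w.
Qed.

(* A longest simple walk starts at a leaf: otherwise a second edge at its first
   node either extends it or closes a circuit. *)
Lemma acyclic_leaf B :
    two_ended B -> acyclic B -> B != set0 ->
  exists a x, [/\ a \in B, ends a x & forall b, b \in B -> ends b x -> b = a].
Proof.
move=> tB cB /set0Pn[a0 a0B]; apply: boolp.contrapT => noleaf.
have more a x : a \in B -> ends a x -> exists b, [/\ b \in B, ends b x & b != a].
  move=> aB ax; apply: boolp.contrapT => nob; apply: noleaf; exists a, x; split=> //.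
  by move=> b bB bx; apply/eqP/negPn/negP => ba; apply: nob; exists b.
(* Without a leaf, simple walks of every length exist; length [#|N|.+1] contradicts the finiteness
   of [N]. *)
have long k : exists x p,
    [/\ walk ends B x p, uniq (x :: unzip2 p) & size p = k.+1].
  elim: k => [|k [x [[|[a y] p]]] [w u //= [sp]]].
    have /card_gt0P[x] : (0 < #|[set x | ends a0 x]|)%N by rewrite tB.
    rewrite inE => a0x; have [y a0y xy] := other_end tB a0B a0x.
    by exists x, [:: (a0, y)]; split; rewrite //= ?inE ?a0B ?a0x ?a0y ?xy.
  have /= /and5P[aB ax ay xy wp] := w.
  have [b [bB bx ba]] := more a x aB ax.
  have [z bz xz] := other_end tB bB bx.
  have [zp|zp] := boolP (z \in x :: unzip2 ((a, y) :: p)); last first.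
    exists z, [:: (b, x), (a, y) & p]; split; last by rewrite /= sp.
      by rewrite [walk _ _ _ _]/= bB bz bx eq_sym xz.
    by rewrite -/(unzip2 _) [uniq _]/= zp.
  (* If the new node [z] is already on the walk, the initial part up to [z], preceded by [b] from
     [z] to [x], is a circuit. *)
  case/negP: (cB z ((b, x) :: take (index z (unzip2 ((a, y) :: p))).+1 ((a, y) :: p))).
  set q := (a, y) :: p in w u zp *; set i := index z _.
  have zq : z \in unzip2 q by move: zp; rewrite inE eq_sym (negPf xz).
  have wq : walk ends B x (take i.+1 q).
    by move: w; rewrite -{1}[q](cat_take_drop i.+1) walk_cat => /andP[].
  have uq : uniq (x :: unzip2 (take i.+1 q)).
    rewrite /unzip2 map_take; apply: subseq_uniq u.
    exact: (cat_subseq (subseq_refl [:: x]) (take_subseq _ _)).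
  have endq : walk_end x (take i.+1 q) = z.
    rewrite /walk_end /unzip2 map_take (take_nth z) ?index_mem //.
    by rewrite last_rcons nth_index.
  have uE := simple_walk_uniq_edges tB wq uq.
  have bq : b \notin unzip1 (take i.+1 q).
    move: wq uq; rewrite /= => /and5P[_ _ _ _ wq] /andP[xq _].
    rewrite inE negb_or ba; apply: contraL bx; exact: (walk_avoid tB wq xq).
  apply/and5P; split=> //; last by apply/andP.
    by apply/and5P; split=> //; rewrite eq_sym.
  by apply/eqP.
have [x [p [_ up sp]]] := long #|N|.
have := card_uniqP up; rewrite /= size_map sp => cp.
by have := max_card (mem (x :: unzip2 p)); rewrite cp ltnNge ltnW.
Qed.

(** A forest is built by adding one edge at a time, each with an end [x] that no earlier edge
    touches, so a value at [x] can be chosen without disturbing the earlier edges. *)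
Lemma acyclic_ind (P : {set A} -> Prop) B :
    two_ended B -> acyclic B -> P set0 ->
    (forall B' a x, a \in B -> B' \subset B -> ends a x ->
       (forall b, b \in B' -> ~~ ends b x) -> P B' -> P (a |: B')) ->
  P B.
Proof.
move=> tB cB P0 PS.
suff H n B' : #|B'| = n -> B' \subset B -> P B' by exact: (H #|B| B).
elim: n B' => [|n IHn] B' cardB' sB'; first by rewrite (cards0_eq cardB').
have [|a [x [aB' ax leaf]]] :=
  acyclic_leaf (two_ended_sub sB' tB) (acyclic_sub sB' cB).
  by rewrite -card_gt0 cardB'.
have sD : B' :\ a \subset B by apply: subset_trans (subD1set _ _) sB'.
rewrite -(setD1K aB'); apply: (PS _ _ x) => //; first exact: (subsetP sB').
  by move=> b; rewrite !inE => /andP[ba bB']; apply: contra ba => /leaf->.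
apply: IHn => //; apply/eqP; move/eqP: cardB'.
by rewrite (cardsD1 a) aB'.
Qed.

(** * Linear equations on a forest whose incidence coefficients square to 1 *)

Section Signs.
Variables (R : comPzRingType) (s : A -> N -> R).
Hypothesis s0 : forall a x, ~~ ends a x -> s a x = 0.
Hypothesis s1 : forall a x, ends a x -> s a x * s a x = 1.

(* Changing the value at a leaf only affects its unique edge. *)
Lemma acyclic_solve B (z : A -> R) :
    two_ended B -> acyclic B ->
  exists b : {ffun N -> R}, {in B, forall a, \sum_x b x * s a x = z a}.
Proof.
move=> tB cB; apply: (@acyclic_ind (fun B => exists b : {ffun N -> R},
  {in B, forall a, \sum_x b x * s a x = z a}) B) => //.
  by exists [ffun=> 0] => a; rewrite inE.
move=> B' a x aB sB' ax leaf [b bP].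
(* The defect of the equation at [a], divided by [s a x], which is its own inverse. *)
pose t := (z a - \sum_y b y * s a y) * s a x.
exists [ffun y => b y + (if y == x then t else 0)] => d; rewrite !inE => dB'.
have E c : \sum_y [ffun y => b y + (if y == x then t else 0)] y * s c y =
    \sum_y b y * s c y + t * s c x.
  under eq_bigr => y _ do rewrite ffunE mulrDl.
  rewrite big_split /=; congr (_ + _).
  rewrite (bigD1 x) //= eqxx big1 ?addr0 // => y /negPf->.
  by rewrite mul0r.
rewrite E; case/predU1P: dB' => [->|dB'].
  by rewrite /t -mulrA s1 // mulr1 addrC subrK.
by rewrite bP // s0 ?leaf // mulr0 addr0.
Qed.

(** When a leaf is added, the homogeneous equation of its edge forces the value there to be plus or
    minus the value at the other end. *)
Lemma acyclic_signs B :
    two_ended B -> acyclic B ->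
  exists2 b : {ffun N -> R}, (forall x, b x * b x = 1)
    & {in B, forall a, \sum_x b x * s a x = 0}.
Proof.
move=> tB cB; apply: (@acyclic_ind (fun B => exists2 b : {ffun N -> R},
  (forall x, b x * b x = 1) & {in B, forall a, \sum_x b x * s a x = 0}) B) => //.
  by exists [ffun=> 1] => a; rewrite ?inE // ffunE mulr1.
move=> B' a x aB sB' ax leaf [b b1 bP].
have [y ay xy] := other_end tB aB ax.
pose t := - (b y * s a y * s a x).
exists [ffun z => if z == x then t else b z] => [z|d].
  rewrite ffunE; case: ifP => // _.
  by rewrite /t mulrNN mulrACA s1 // mulr1 mulrACA b1 s1 // mulr1.
rewrite !inE => /predU1P[->|dB'].
  rewrite (sum_two_ends tB aB ax ay xy) => [|z /s0->]; last exact: mulr0.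
  rewrite !ffunE eqxx eq_sym (negPf xy) /t mulNr -(mulrA _ (s a x)) s1 // mulr1.
  exact: addNr.
rewrite -[RHS](bP d dB'); apply: eq_bigr => z _; rewrite ffunE.
by case: eqP => // ->; rewrite s0 ?leaf // !mulr0.
Qed.

(** Otherwise the support of [c] is a nonempty forest, and at one of its leaves the cycle equation
    has a single nonzero term. *)
Lemma acyclic_cycle0 B (c : A -> R) :
    two_ended B -> acyclic B -> (forall a, a \notin B -> c a = 0) ->
    (forall x, \sum_a c a * s a x = 0) ->
  forall a, c a = 0.
Proof.
move=> tB cB c0 cyc a; apply/eqP/negPn/negP => ca.
have sB : [set a | c a != 0] \subset B.
  by apply/subsetP => b; rewrite inE; apply: contraR => /c0->.
have [|b [x [cb bx leaf]]] :=
    acyclic_leaf (two_ended_sub sB tB) (acyclic_sub sB cB).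
  by apply/set0Pn; exists a; rewrite inE.
move: cb; rewrite inE => /eqP; apply.
have := cyc x; rewrite (bigD1 b) //= big1 => [|d db]; last first.
  have [->|cd] := eqVneq (c d) 0; first exact: mul0r.
  rewrite s0 ?mulr0 //; apply: contra db => dx.
  by apply/eqP/leaf; rewrite ?inE.
by rewrite addr0 => /(congr1 ( *%R^~ (s b x))); rewrite mul0r -mulrA s1 // mulr1.
Qed.

End Signs.

(* The coboundary on 'F_2-valued functions is onto, with kernel the functions
   that are constant on the components. *)
Lemma forest_card (Q : finType) (k : N -> Q) (r : Q -> N) B :
    two_ended B -> acyclic B -> cancel r k ->
    (forall a x y, a \in B -> ends a x -> ends a y -> k x = k y) ->
    (forall x y, k x = k y -> exists2 p, walk ends B x p & walk_end x p = y) ->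
  #|N| = (#|B| + #|Q|)%N.
Proof.
move=> tB cB rK kB kW.
pose s a x : 'F_2 := (ends a x)%:R.
(* The coboundary together with the values at the representatives [r q]. Over ['F_2] all function
   spaces are finite, so bijectivity of [d] compares powers of 2 and gives the count. *)
pose d (b : {ffun N -> 'F_2}) : {ffun {a | a \in B} -> 'F_2} * {ffun Q -> 'F_2} :=
  ([ffun a => \sum_x b x * s (val a) x], [ffun q => b (r q)]).
have addF2 (u v : 'F_2) : u + v = 0 -> u = v.
  by move/eqP; rewrite addr_eq0 (oppr_pchar2 (pchar_Fp _)) // => /eqP.
have s0 a x : ~~ ends a x -> s a x = 0 by rewrite /s => /negPf->.
have s1 a x : ends a x -> s a x * s a x = 1 by rewrite /s => ->; rewrite mulr1.
have dinj : injective d.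
  move=> b b' [/ffunP db /ffunP rb]; apply/ffunP => x.
  have [p wp <-] := kW (r (k x)) x (rK _).
  apply: (@walk_invariant (fun x => b x = b' x) B) wp _; last first.
    by have := rb (k x); rewrite !ffunE.
  move=> a y z aB ay az yz byb.
  have := db (exist _ a aB); rewrite !ffunE /=.
  have E b1 := sum_two_ends (F := fun x => b1 x * s a x) tB aB ay az yz.
  rewrite !E => [|u /s0->|u /s0->]; rewrite ?mulr0 //.
  by rewrite byb => /addrI; rewrite /s az !mulr1.
have dsurj u : exists b, d b = u.
  case: u => z q.
  pose z' a := if insub a is Some a' then z a' else 0.
  have [b bP] := acyclic_solve s0 s1 z' tB cB.
  (* The correction is constant on the fibres of [k], so its coboundary is a sum of two equal terms
     and vanishes in ['F_2]. *)
  exists [ffun x => b x + (q (k x) - b (r (k x)))]; congr (_, _); apply/ffunP.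
    move=> [a aB]; rewrite ffunE /=.
    have : \sum_x b x * s a x = z (exist _ a aB) by rewrite bP // /z' insubT.
    move=> <-; under eq_bigr => x _ do rewrite ffunE mulrDl.
    rewrite big_split /= [X in _ + X](_ : _ = 0) ?addr0 //.
    have [x ax] : exists x, ends a x.
      have /card_gt0P[x] : (0 < #|[set x | ends a x]|)%N by rewrite tB.
      by rewrite inE; exists x.
    have [y ay xy] := other_end tB aB ax.
    rewrite (sum_two_ends tB aB ax ay xy) => [|u /s0->]; last exact: mulr0.
    by rewrite (kB a x y) // /s ax ay mulr1 -mulr2n (mulrn_pchar (pchar_Fp _)).
  by move=> x; rewrite !ffunE rK addrC subrK.
have dbij : bijective d.
  have /boolp.choice[h hK] := dsurj.
  by exists h => // b; apply: dinj; rewrite hK.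
have := bij_eq_card dbij; rewrite card_prod !card_ffun card_Fp // card_sig.
by rewrite -expnD => /eqP; rewrite eqn_exp2l // => /eqP.
Qed.

End Forest.

(** * First homology groups with one relation *)

Lemma intr_Z2_eq0 (n : int) : (n%:~R == 0 :> 'Z_2) = (2 %| n)%Z.
Proof. by rewrite -(dvdz_pcharf (pchar_Fp (isT : prime 2))). Qed.

Section Homology.
Variable X : cwcomplex.

Lemma hclass_eq (z z' : cycle1 X) : hclass z = hclass z' <-> is_boundary1 (z - z').
Proof.
have E : is_boundary1 (z - z') = (hclass z == hclass z').
  exact: (Quotient.idealrBE (boundaries1 X)).
by rewrite E; split=> /eqP.
Qed.

Lemma hclass_zmod_morphism : zmod_morphism (@hclass X).
Proof. by move=> z z'; rewrite /hclass raddfB. Qed.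

Lemma hclass_surj (q : H1 X) : exists z, hclass z = q.
Proof. by exists (repr q); rewrite /hclass reprK. Qed.

(** First isomorphism theorem: the kernel of [psi] is the group of boundaries, so evaluating [psi]
    at the representative [repr q] is well defined on classes. *)
Lemma H1_iso (W : zmodType) (psi : cycle1 X -> W) :
    zmod_morphism psi -> (forall w, exists z, psi z = w) ->
    (forall z, psi z = 0 <-> is_boundary1 z) ->
  zmod_isomorphic (H1 X) W.
Proof.
move=> psiB psi_surj psi0.
pose phi (q : H1 X) := psi (repr q).
have psi_eq z z' : psi z = psi z' <-> hclass z = hclass z'.
  rewrite hclass_eq -psi0 psiB; split=> [->|/eqP]; first exact: subrr.
  by rewrite subr_eq0 => /eqP.
have phiE z : phi (hclass z) = psi z.
  by apply/psi_eq; rewrite /hclass reprK.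
have phiB : zmod_morphism phi.
  move=> q q'; have [z <-] := hclass_surj q; have [z' <-] := hclass_surj q'.
  by rewrite -hclass_zmod_morphism !phiE psiB.
pose phiA : {additive H1 X -> W} :=
  HB.pack phi (GRing.isZmodMorphism.Build _ _ phi phiB).
exists phiA.
have /boolp.choice[h hK] := psi_surj.
exists (fun w => hclass (h w)) => [q|w]; last by rewrite /= phiE.
have [z <-] := hclass_surj q.
by apply/psi_eq; rewrite hK /= phiE.
Qed.

(** * Quotients of a free group by twice a vector with a unit coordinate *)

Section OneRelation.
Variables (g : nat) (psi : cycle1 X -> 'rV[int]_g) (h : 'rV[int]_g) (i0 : 'I_g).
Hypothesis psiB : zmod_morphism psi.
Hypothesis psi_surj : forall w, exists z, psi z = w.
Hypothesis psi_bd : forall z, is_boundary1 z <-> exists k : int, psi z = (k * 2) *: h.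
Hypothesis h_unit : h 0 i0 * h 0 i0 = 1.

(** Since [h 0 i0] is a sign, [h] and the standard basis vectors other than the one at [i0] form a
    basis. Subtracting a multiple of [h] clears the coordinate at [i0]; the other coordinates stay
    free, and the relation [2 *: h] leaves only a parity at [i0]. *)
Lemma H1_one_relation : zmod_isomorphic (H1 X) ('rV[int]_g.-1 * 'Z_2)%type.
Proof.
pose phi z : 'rV[int]_g.-1 * 'Z_2 :=
  (\row_j (psi z 0 (lift i0 j) - h 0 (lift i0 j) * h 0 i0 * psi z 0 i0),
   (psi z 0 i0)%:~R).
apply: (@H1_iso _ phi) => [z z'|[w u]|z].
- congr (_, _); last by rewrite psiB !mxE intrB.
  apply/rowP => j; rewrite psiB !mxE; ring.
- pose b : int := (u : nat)%:Z.
  have [z zE] := psi_surj (\row_i if unlift i0 i is Some j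
     then w 0 j + h 0 i * h 0 i0 * b else b).
  exists z; rewrite /phi zE; congr (_, _); last first.
    by rewrite mxE unlift_none /b; apply: natr_Zp.
  by apply/rowP => j; rewrite !mxE liftK unlift_none addrK.
rewrite psi_bd; split=> [|[k zE]]; last first.
  congr (_, _); last first.
    apply/eqP; rewrite intr_Z2_eq0 zE !mxE; apply/dvdzP; exists (k * h 0 i0).
    by rewrite mulrAC.
  apply/rowP => j; rewrite zE !mxE.
  rewrite (_ : _ - _ = k * 2 * h 0 (lift i0 j) * (1 - h 0 i0 * h 0 i0)); last by ring.
  by rewrite h_unit subrr mulr0.
case=> /rowP z0 /eqP; rewrite intr_Z2_eq0 => /dvdzP[m zm].
(* At [i0] the required equality reads [m * 2 = k * 2 * h 0 i0], and the sign [h 0 i0] is its own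
   inverse. *)
exists (m * h 0 i0); apply/rowP => i; rewrite mxE.
case: (unliftP i0 i) => [j|] ->; last first.
  rewrite zm (_ : m * _ * 2 * _ = m * 2 * (h 0 i0 * h 0 i0)); last by ring.
  by rewrite h_unit mulr1.
have := z0 j; rewrite !mxE => /eqP; rewrite subr_eq0 => /eqP->; rewrite zm.
ring.
Qed.

(** A vector with a nonzero multiple on the line of [h] is itself an integral multiple of [h], the
    factor being read off at the unit coordinate [i0]; conversely [2 *: h] is a relation. *)
Lemma one_relation_torsion z0 : psi z0 = h -> generates_torsion (hclass z0).
Proof.
pose psiA : {additive cycle1 X -> 'rV[int]_g} :=
  HB.pack psi (GRing.isZmodMorphism.Build _ _ psi psiB).
pose hA : {additive cycle1 X -> H1 X} :=
  HB.pack (@hclass X) (GRing.isZmodMorphism.Build _ _ _ hclass_zmod_morphism).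
have psiE : psi = psiA by [].
have hE : @hclass X = hA by [].
have bdP z : hclass z = 0 <-> exists k : int, psi z = (k * 2) *: h.
  by rewrite -psi_bd -[z in is_boundary1 z]subr0 -hclass_eq hE raddf0.
move=> z0h q; have [z <-] := hclass_surj q; split=> [[n n_gt0]|[k ->]].
  rewrite hE -raddfMn -hE bdP psiE raddfMn => -[k nz].
  exists (psi z 0 i0 * h 0 i0); rewrite hE -raddfMz -hE hclass_eq psi_bd.
  exists 0; rewrite psiE raddfB raddfMz -psiE z0h mul0r scale0r.
  apply/eqP; rewrite subr_eq0; apply/eqP/rowP => i.
  have E i1 : psi z 0 i1 * n%:Z = k * 2 * h 0 i1.
    by rewrite -[n%:Z]natz mulr_natr -mulmxnE psiE nz [LHS]mxE.
  have nn : n%:Z != 0 by rewrite -lt0n.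
  apply: (mulIf nn); rewrite E -scaler_int mxE intz.
  rewrite (_ : _ * _ * n%:Z = (psi z 0 i0 * n%:Z) * h 0 i0 * h 0 i); last by ring.
  rewrite E (_ : k * 2 * _ * _ * _ = k * 2 * h 0 i * (h 0 i0 * h 0 i0)); last by ring.
  by rewrite h_unit mulr1.
exists 2%N => //; rewrite hE -raddfMz -raddfMn -hE bdP; exists k.
by rewrite psiE raddfMn raddfMz -psiE z0h -scaler_int intz -scaler_nat scalerA mulrC.
Qed.
End OneRelation.
End Homology.

(** * Chains of a complex and of its collapse *)

Lemma ffun_mulrzE (I : finType) (u : {ffun I -> int}) (k : int) i :
  (u *~ k) i = u i * k.
Proof.
case: k => n; rewrite ?NegzE ?mulrNz ?ffunE -pmulrn ffunMnE -mulr_natr natz //.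
by rewrite mulrN.
Qed.

Lemma ffun_addE (I : finType) (u v : {ffun I -> int}) i : (u + v) i = u i + v i.
Proof. by rewrite ffunE. Qed.

Lemma ffun_subE (I : finType) (u v : {ffun I -> int}) i : (u - v) i = u i - v i.
Proof. by rewrite !ffunE. Qed.

Section Chains.
Variable K : cwcomplex.
Implicit Types (e a : cell1 K) (v w x y : cell0 K) (B : {set cell1 K}).
Implicit Types (p : seq (cell1 K * cell0 K)).
Hypothesis Ksimp : simplicial_cells K.

Lemma is_end_two_ended B : two_ended (@is_end K) B.
Proof. by case: Ksimp => _ h _ _ a _; apply: h. Qed.

Lemma inc1_sqr e v : is_end e v -> inc1 e v * inc1 e v = 1.
Proof.
case: Ksimp => /(_ e v) + _ _ _; rewrite /is_end !inE.
by case/or3P=> /eqP->.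
Qed.

Lemma inc2_sqr f e : is_side e f -> inc2 f e * inc2 f e = 1.
Proof.
case: Ksimp => _ _ /(_ f e) + _; rewrite /is_side !inE.
by case/or3P=> /eqP->.
Qed.

Lemma inc1_nend e v : ~~ is_end e v -> inc1 e v = 0.
Proof. by move/negPn/eqP. Qed.

Lemma inc2_nside e f : ~~ is_side e f -> inc2 f e = 0.
Proof. by move/negPn/eqP. Qed.

Lemma inc1_opp a x y : is_end a x -> is_end a y -> x != y -> inc1 a x = - inc1 a y.
Proof.
move=> ax ay xy; apply/eqP; rewrite -addr_eq0.
rewrite -(sum_two_ends (@is_end_two_ended setT) (in_setT a) ax ay xy).
  by rewrite inc_augmentation.
exact: inc1_nend.
Qed.

Lemma walk_chain_cons a y p b :
  walk_chain ((a, y) :: p) b = (if a == b then inc1 b y else 0) + walk_chain p b.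
Proof. by rewrite !ffunE big_cons /=; case: ifP; rewrite ?add0r. Qed.

Lemma walk_chain_notin p b : b \notin unzip1 p -> walk_chain p b = 0.
Proof.
elim: p => [|[a y] p IHp] /=; first by rewrite ffunE big_nil.
rewrite inE negb_or eq_sym walk_chain_cons => /andP[/negPf-> /IHp->].
exact: addr0.
Qed.

(** The incidence numbers of an edge at its ends are opposite signs, so each step contributes its
    target minus its source and the sum telescopes. *)
Lemma bd1_walk_chain B x p : walk (@is_end K) B x p ->
  forall v, bd1 (walk_chain p) v = (v == walk_end x p)%:R - (v == x)%:R.
Proof.
move=> + v; elim: p x => [|[a y] p IHp] x /=.
  rewrite subrr ffunE big1 // => e _.
  by rewrite walk_chain_notin // mul0r.
case/and5P=> aB ax ay xy /IHp; rewrite /walk_end /= !ffunE => IH.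
under eq_bigr => e _ do rewrite walk_chain_cons mulrDl.
rewrite big_split /= IH addrC (bigD1 a) //= eqxx big1 ?addr0; last first.
  by move=> e; rewrite eq_sym => /negPf->; rewrite mul0r.
rewrite -addrA; congr (_ + _).
have [->|vy] := eqVneq v y.
  by rewrite eq_sym (negPf xy) inc1_sqr // subr0 addNr.
rewrite oppr0 add0r; have [->|vx] := eqVneq v x.
  by rewrite (inc1_opp ax ay xy) mulrN inc1_sqr.
rewrite [inc1 a v]inc1_nend ?mulr0 ?oppr0 //.
by rewrite (two_endedE (@is_end_two_ended setT) (in_setT a) ax ay xy) negb_or vx.
Qed.

Lemma ends_of_edge e : exists v w, inc1 e v = - 1 /\ inc1 e w = 1.
Proof.
have /card_gt0P[x] : (0 < #|[set x | is_end e x]|)%N by case: Ksimp => _ ->.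
rewrite inE => ex.
have [y ey xy] := other_end (@is_end_two_ended setT) (in_setT e) ex.
have := inc1_opp ex ey xy.
case: Ksimp => /(_ e y) + _ _ _; move: ey; rewrite /is_end !inE.
move=> ey /or3P[] /eqP yE xE; last by exists x, y; rewrite xE yE.
  by exists y, x; rewrite xE yE opprK.
by rewrite yE in ey.
Qed.

(** The tree path from the head of [e] back to its tail, preceded by [e], shows that the choice in
    [tree_cycle] succeeds. Whichever circuit is chosen, its edges are distinct, so [e] is traversed
    once, along its orientation. *)
Lemma tree_cycleP (T : {set cell1 K}) e :
    spanning_tree (@is_end K) [set: cell0 K] [set: cell1 K] T -> e \notin T ->
  [/\ bd1 (tree_cycle T e) = 0, tree_cycle T e e = 1
    & forall a, a \notin e |: T -> tree_cycle T e a = 0].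
Proof.
move=> [_ _ conn acyc] eT; rewrite /tree_cycle.
have [v [w [ev ew]]] := ends_of_edge e.
have isv : is_end e v by rewrite /is_end ev.
have isw : is_end e w by rewrite /is_end ew.
have vw : v != w by apply/eqP => vw; move: ev; rewrite vw ew.
case: pickP => [[u [p i]] /=|none]; last first.
  have [p /and3P[wp endp up]] := conn w v (in_setT _) (in_setT _).
  have sp : (size ((e, w) :: p) <= #|cell0 K|)%N.
    by have := max_card (mem (w :: unzip2 p)); rewrite (card_uniqP up) /= size_map.
  suff circ : circuit (@is_end K) (e |: T) v ((e, w) :: p).
    by have := none (v, Bseq sp); rewrite /= circ ev !eqxx.
  apply/and5P; split=> //.
    by apply/and5P; rewrite setU11; split=> //; apply: walk_sub wp; apply: subsetUr.
  apply/andP; split; last exact: (simple_walk_uniq_edges (@is_end_two_ended T) wp up).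
  by apply: contra eT; apply: (walk_edges wp).
case/and3P=> /and5P[_ wp endp u2 u1] /eqP incu /eqP hd.
split.
- apply/ffunP => x; rewrite (bd1_walk_chain wp) (eqP endp) subrr.
  by rewrite ffunE.
- case: p {i} hd wp u1 {endp u2} => [//|[a y] p] /= -[->] wp u1.
  move: wp u1 => /and5P[_ _ ey uy _] /andP[ep _].
  rewrite walk_chain_cons eqxx walk_chain_notin // addr0.
  have iu : is_end e u by rewrite /is_end incu.
  by have := inc1_opp iu ey uy; rewrite incu => /oppr_inj.
move=> a; apply: contraNeq => ca; apply: (walk_edges wp).
by apply: contraNT ca => /walk_chain_notin->.
Qed.

(** A section of [chain_bar]; it need not send cycles to cycles, since a cycle of the collapse may
    jump between vertices of one boundary component. *)
Definition chain_ext (z : chain1 (collapse K)) : chain1 K :=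
  [ffun e => oapp z 0 (insub e)].

Lemma chain_ext_val z (e : cell1 (collapse K)) : chain_ext z (val e) = z e.
Proof. by rewrite ffunE valK. Qed.

Lemma chain_extN z e (h : e \notin bdE K) : chain_ext z e = z (Sub e h).
Proof. by rewrite ffunE insubT. Qed.

Lemma chain_ext_bd z e : e \in bdE K -> chain_ext z e = 0.
Proof. by move=> eb; rewrite ffunE insubF // eb. Qed.

Lemma chain_extK : cancel chain_ext (@chain_bar K).
Proof. by move=> z; apply/ffunP => e; rewrite ffunE chain_ext_val. Qed.

Fact chain_ext_zmod_morphism : zmod_morphism chain_ext.
Proof.
by move=> z z'; apply/ffunP => e; rewrite !ffunE; case: insub => [a|] /=;
  rewrite ?ffunE ?subr0.
Qed.
HB.instance Definition _ :=
  GRing.isZmodMorphism.Build _ _ chain_ext chain_ext_zmod_morphism.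

(** Collapsing commutes with the boundary: a discarded edge has both ends in one component, where
    its incidence numbers cancel. *)
Lemma bd1_chain_bar (c : chain1 K) n :
  bd1 (chain_bar c) n = \sum_(v in \val n) bd1 c v.
Proof.
rewrite ffunE; under [RHS]eq_bigr => v _ do rewrite ffunE.
rewrite exchange_big /= [RHS](bigID (mem (bdE K))) /= [X in _ = X + _]big1 ?add0r.
  rewrite [RHS]big_sub; apply: eq_bigr => e _.
  by rewrite ffunE mulr_sumr.
by move=> e eb; rewrite -mulr_sumr inc1_bdE ?mulr0.
Qed.

Lemma bd2_chain_bar (b : chain2 K) :
  bd2 (X := collapse K) b = chain_bar (bd2 b).
Proof. by apply/ffunP => e; rewrite !ffunE. Qed.

(** * Lifting cycles through the collapse of the boundary components *)

Section Boundary.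
Variable TB : {set cell1 K}.
Hypothesis TBtree : boundary_spanning_trees TB.

(** An interior vertex is alone in its component, so if [v] and [w] differ they lie on the boundary,
    where [TB] contains a spanning tree of their component. *)
Lemma bd_comp_walk v w : to0bar v = to0bar w ->
  exists2 p, walk (@is_end K) TB v p & walk_end v p = w.
Proof.
move=> vw; have [<-|nvw] := eqVneq v w; first by exists [::].
have /[dup] wv : w \in bd_comp v.
  by rewrite bd_comp_eq; move/(congr1 val): vw => /= ->.
rewrite inE => /connectP[[|u s]] /=; first by move=> _ vw'; rewrite vw' eqxx in nvw.
case/andP=> /exists_inP[e eb /andP[ev _]] _ _.
case: TBtree => _ /(_ e v eb ev) [_ _ conn _].
have vv : v \in bd_comp v by rewrite inE connect0.
have [p /and3P[wp /eqP endp _]] := conn v w vv wv.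
by exists p => //; apply: walk_sub wp; apply: subsetIl.
Qed.

(* The boundary of an extended cycle has total weight 0 on each boundary
   component, hence bounds a chain of the spanning trees there. *)
Lemma cycle_bar_lift (z : chain1 (collapse K)) : bd1 z = 0 ->
  exists c : chain1 K, [/\ bd1 c = 0, chain_bar c = z
    & forall e, e \in bdE K -> e \notin TB -> c e = 0].
Proof.
move=> dz.
have /boolp.choice[r rK] (n : cell0bar K) : exists v, to0bar v = n.
  by case: n => C CP; have /imsetP[v _ Cv] := CP; exists v; apply: val_inj.
have /boolp.choice[p pP] v : exists p,
    walk (@is_end K) TB (r (to0bar v)) p /\ walk_end (r (to0bar v)) p = v.
  by have [p wp ep] := bd_comp_walk (rK (to0bar v)); exists p.
pose h := bd1 (chain_ext z).
(* Carries the weight [h v] from the representative of the component to [v] along [TB]; the weights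
   taken at one representative add up to a value of [bd1 z], which is 0. *)
pose b : chain1 K := \sum_v walk_chain (p v) *~ h v.
have b0 e : e \notin TB -> b e = 0.
  move=> eTB; rewrite sum_ffunE big1 // => v _; rewrite ffun_mulrzE.
  rewrite walk_chain_notin ?mul0r //; apply: contra eTB.
  exact: (walk_edges (pP v).1).
exists (chain_ext z - b); split.
- apply/ffunP => w; rewrite raddfB raddf_sum -/h ffun_subE sum_ffunE [RHS]ffunE.
  under eq_bigr => v _ do
    rewrite raddfMz ffun_mulrzE (bd1_walk_chain (pP v).1) (pP v).2 mulrBl.
  rewrite big_split /= sumrN (bigD1 w) //= eqxx mul1r big1 ?addr0; last first.
    by move=> v; rewrite eq_sym => /negPf->; rewrite mul0r.
  rewrite [X in _ - X](_ : _ = h w - 0); last first.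
    congr (_ - _); rewrite (partition_big (@to0bar K) xpredT) //= big1 // => n _.
    under eq_bigr => v /eqP-> do [].
    rewrite -mulr_sumr; under eq_bigl => v do rewrite -to0barE.
    by rewrite -bd1_chain_bar chain_extK dz ffunE mulr0.
  by rewrite subr0 /h ffunE subrr.
- apply/ffunP => e; rewrite ffunE ffun_subE chain_ext_val b0 ?subr0 //.
  by case: TBtree => /subsetP sTB _; apply: contra (valP e) => /sTB.
by move=> e eb /b0 be; rewrite ffun_subE be chain_ext_bd // subr0.
Qed.

(** The lift of [z] vanishes outside [T], on the boundary edges as well, and a forest carries no
    nonzero cycle. *)
Lemma cycle_bar_eq0 (T : {set cell1 K}) (z : chain1 (collapse K)) :
    TB \subset T -> acyclic (@is_end K) T -> bd1 z = 0 ->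
    (forall e : cell1bar K, val e \notin T -> z e = 0) ->
  z = 0.
Proof.
move=> sT aT dz z0; have [c [dc cz cb]] := cycle_bar_lift dz.
have c0 : forall e, c e = 0.
  apply: (acyclic_cycle0 inc1_nend inc1_sqr (@is_end_two_ended T) aT) => [e eT|x].
    have [eb|eb] := boolP (e \in bdE K).
      by apply: cb => //; apply: contra eT; apply: subsetP.
    by have := z0 (Sub e eb) eT; rewrite -cz ffunE.
  by move/ffunP/(_ x): dc; rewrite !ffunE.
by apply/ffunP => e; rewrite -cz !ffunE.
Qed.

End Boundary.
End Chains.

(** * Elimination of the cotree *)

Section TreeCotreeHomology.
Variables (K : cwcomplex) (TB T Tc : {set cell1 K}) (f : cell2 K).
Implicit Types (e d : cell1 K) (x y : cell2 K) (z : chain1 (collapse K)).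
Hypothesis Ksurf : triangulated_surface K.
Hypothesis TBtree : boundary_spanning_trees TB.
Hypothesis sTB : TB \subset T.
Hypothesis Ttree : spanning_tree (@is_end K) [set: cell0 K] [set: cell1 K] T.
Hypothesis Tctree : dual_spanning_tree T Tc.
Let Td := extended_dual_tree T Tc.
Let Ksimp : simplicial_cells K. Proof. by case: Ksurf. Qed.
Let Tacyclic : acyclic (@is_end K) T. Proof. by case: Ttree. Qed.
Let Tcacyclic : acyclic (@is_side K) Tc. Proof. by case: Tctree. Qed.
Let s2 e x := inc2 x e.
Let s2_0 e x : ~~ is_side e x -> s2 e x = 0. Proof. exact: inc2_nside. Qed.
Let s2_1 e x : is_side e x -> s2 e x * s2 e x = 1.
Proof. exact: (inc2_sqr Ksimp). Qed.

Lemma cotreeP d : d \in Tc -> d \notin T /\ d \notin bdE K.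
Proof.
by case: Tctree => /subsetP/(_ d) + _ _ _ dTc => /(_ dTc); rewrite !inE => /andP[].
Qed.

(** The extended dual tree absorbs every boundary edge outside [T], so only interior edges
    remain. *)
Lemma EM_P e :
  (e \in EM T Td) = [&& e \notin T, e \notin bdE K & e \notin Tc].
Proof.
by rewrite [e \in bdE K]inE !inE; case: (e \in T) => //=; rewrite negb_or andbC.
Qed.

Lemma interior_two_ended (B : {set cell1 K}) :
  {in B, forall d, d \notin bdE K} -> two_ended (@is_side K) B.
Proof.
move=> Bint d /Bint; rewrite inE => d1.
case: Ksurf => _ _ _ /(_ d) + _; rewrite !inE (negPf d1) => /eqP <-.
by [].
Qed.

Lemma cotree_two_ended : two_ended (@is_side K) Tc.
Proof. by apply: interior_two_ended => d /cotreeP[]. Qed.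

(** A boundary edge lies in a single face, so no step between distinct faces can cross it. *)
Lemma extended_dual_walk x p :
  walk (@is_side K) Td x p -> walk (@is_side K) Tc x p.
Proof.
elim: p x => //= -[d y] p IHp x /and5P[dTd dx dy xy /IHp ->].
rewrite dx dy xy !andbT; move: dTd; rewrite !inE => /orP[//|/andP[_ d1]].
have /cards1P[u /setP du] := d1.
move: (du x) (du y); rewrite !inE dx dy => /esym/eqP xu /esym/eqP yu.
by rewrite xu yu eqxx in xy.
Qed.

Let Xi := [ffun x => xi Td f x].

(** The forest [Tc] admits a system of signs [u] satisfying these equations with value 1 at [f].
    Transport along any walk in the tree reproduces [u], so [xi] equals [u] whichever path is
    picked. *)
Lemma xi_signs :
  [/\ xi Td f f = 1, (forall x, xi Td f x * xi Td f x = 1)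
    & {in Tc, forall d, \sum_x xi Td f x * inc2 x d = 0}].
Proof.
have [b b1 bTc] := acyclic_signs s2_0 s2_1 cotree_two_ended Tcacyclic.
pose u x := b f * b x.
have uTc : {in Tc, forall d, \sum_x u x * inc2 x d = 0}.
  move=> d /bTc dTc; under eq_bigr => x _ do rewrite -mulrA.
  by rewrite -mulr_sumr [X in _ * X]dTc mulr0.
have u1 x : u x * u x = 1 by rewrite mulrACA !b1.
suff E x : xi Td f x = u x.
  split=> [|x|d dTc]; rewrite ?E //; first exact: b1.
  by rewrite -[RHS](uTc d dTc); apply: eq_bigr => x _; rewrite E.
have tr p y : walk (@is_side K) Tc y p -> transport (u y) y p = u (walk_end y p).
  elim: p y => //= -[d w] p IHp y /and5P[dTc dy dw yw wp].
  rewrite -[walk_end y _]/(walk_end w p) -IHp //; congr transport.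
  have := uTc d dTc.
  rewrite (sum_two_ends cotree_two_ended dTc dy dw yw); last first.
    by move=> v /s2_0; rewrite /s2 => ->; rewrite mulr0.
  (* Each of -1, 0 and 1 is its own inverse in [int], so the division in [transport] is a
     multiplication. *)
  have wd : (inc2 w d)^-1 = inc2 w d.
    by case: Ksimp => _ _ /(_ w d) + _; rewrite !inE => /or3P[] /eqP ->.
  have := s2_1 dw; rewrite /s2 wd => wd1 /eqP; rewrite addr_eq0 => /eqP ->.
  by rewrite mulNr opprK -mulrA wd1 mulr1.
rewrite /xi; case: pickP => [p /and3P[wp /eqP <- _]|none].
  by rewrite -tr ?extended_dual_walk // /u b1.
case: Tctree => _ _ /(_ f x (in_setT _) (in_setT _)) [p /and3P[wp ep up]] _.
have sp : (size p <= #|cell2 K|)%N.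
  have := max_card (mem (f :: unzip2 p)).
  by rewrite (card_uniqP up) /= size_map => /ltnW.
have := none (Bseq sp); rewrite /simple_path ep up (walk_sub _ wp) //.
exact: subsetUl.
Qed.

Lemma morse_incE e : morse_inc Td f e = bd2 Xi e.
Proof.
rewrite /morse_inc ffunE big_mkcond; apply: eq_bigr => x _ /=.
by rewrite ffunE; case: ifPn => // /inc2_nside ->; rewrite mulr0.
Qed.

(** Each of the two faces at an interior edge contributes a product of two signs. *)
Lemma morse_inc_val e : e \notin bdE K -> morse_inc Td f e \in [:: 0; 2; - 2].
Proof.
move=> eb; have te : two_ended (@is_side K) [set e].
  by apply: interior_two_ended => d; rewrite inE => /eqP->.
have ee : e \in [set e] by rewrite inE.
have [|[x]] := set_0Vmem [set x | is_side e x].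
  by move/eqP; rewrite -cards_eq0 te.
rewrite inE => ex; have [y ey xy] := other_end te ee ex.
rewrite morse_incE ffunE (sum_two_ends te ee ex ey xy); last first.
  by move=> w /inc2_nside ->; rewrite mulr0.
rewrite !ffunE; case: xi_signs => _ x1 _.
have sgn (a : int) : a * a = 1 -> a = 1 \/ a = - 1.
  move/eqP; rewrite -expr2 -[X in _ == X](expr1n _ 2) eqf_sqr.
  by case/orP=> /eqP; [left|right].
have := inc2_sqr Ksimp ex; have := inc2_sqr Ksimp ey.
have := x1 x; have := x1 y.
by do 4!case/sgn=> ->.
Qed.

(** Vanishing on an edge of [Tc] fixes the ratio of the coefficients of its two faces, the same
    ratio as for [xi]; this propagates from [f] along the tree. *)
Lemma cotree_cocycle (b : chain2 K) :
  {in Tc, forall d, bd2 b d = 0} -> b = Xi *~ b f.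
Proof.
move=> bTc; have [xif _ xiTc] := xi_signs.
apply/ffunP => x; rewrite ffun_mulrzE ffunE.
case: Tctree => _ _ /(_ f x (in_setT _) (in_setT _)) [p /and3P[wp /eqP <- _]] _.
apply: (walk_invariant (P := fun x => b x = xi Td f x * b f) _ wp); last first.
  by rewrite xif mul1r.
move=> d y w dTc dy dw yw byE.
have E := sum_two_ends cotree_two_ended dTc dy dw yw.
have := bTc d dTc; rewrite ffunE E => [|v /inc2_nside ->]; last exact: mulr0.
have := xiTc d dTc; rewrite E => [|v /inc2_nside ->]; last exact: mulr0.
move=> /eqP; rewrite addrC addr_eq0 => /eqP xw /eqP; rewrite addrC addr_eq0 => /eqP bw.
have wd := inc2_sqr Ksimp dw.
rewrite -[b w]mulr1 -[xi _ _ w]mulr1 -wd !mulrA bw xw byE; ring.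
Qed.

(** The equations on the forest [Tc] are solvable for every right-hand side; the chains obtained
    serve to cancel the cotree coefficients of a cycle. *)
Lemma cotree_dual_basis : exists b : cell1 K -> chain2 K,
  forall e, {in Tc, forall d, bd2 (b e) d = (d == e)%:R}.
Proof.
have /boolp.choice[b bP] e : exists b : chain2 K,
    {in Tc, forall d, bd2 b d = (d == e)%:R}.
  have [b bP] :=
    acyclic_solve s2_0 s2_1 (fun d => (d == e)%:R) cotree_two_ended Tcacyclic.
  by exists b => d dTc; rewrite ffunE -bP.
by exists b.
Qed.

(** * Cycles modulo boundaries in the coordinates indexed by [EM T Td] *)

Section Reduction.
Variable b : cell1 K -> chain2 K.
Hypothesis bP : forall e, {in Tc, forall d, bd2 (b e) d = (d == e)%:R}.

(* Coordinates modulo boundaries, once the cotree edges are eliminated. *)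
Definition cotree_filling z : chain2 K := \sum_(d in Tc) b d *~ chain_ext z d.

Definition EM_coord z : 'rV[int]_#|EM T Td| :=
  \row_i (chain_ext z - bd2 (cotree_filling z)) (enum_val i).

Lemma EM_coord_zmod_morphism : zmod_morphism EM_coord.
Proof.
move=> z z'; apply/rowP => i; rewrite !mxE.
have -> : cotree_filling (z - z') = cotree_filling z - cotree_filling z'.
  rewrite -sumrB; apply: eq_bigr => d _; rewrite -mulrzBr.
  by congr (_ *~ _); rewrite raddfB !ffunE.
by rewrite !raddfB !ffunE; ring.
Qed.

Lemma bd2_cotree_filling z : {in Tc, forall d, bd2 (cotree_filling z) d = chain_ext z d}.
Proof.
move=> d dTc; rewrite raddf_sum sum_ffunE (bigD1 d) //= big1 => [|d' /andP[_ dd']].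
  by rewrite raddfMz ffun_mulrzE bP // eqxx mul1r addr0.
by rewrite raddfMz ffun_mulrzE bP // eq_sym (negPf dd') mul0r.
Qed.

(** If [z] bounds [c], then [c] minus the filling has boundary 0 on [Tc], hence is a multiple of
    [Xi]. Conversely, [z] minus the boundary of [Xi *~ k] plus the filling is a cycle vanishing
    outside [T], hence 0. *)
Lemma EM_coord_boundary z : bd1 z = 0 ->
  (exists c, bd2 (X := collapse K) c = z) <->
  exists k : int, EM_coord z = k *: \row_i morse_inc Td f (enum_val i).
Proof.
move=> dz; have [_ _ xiTc] := xi_signs; split=> [[c cz]|[k /rowP zk]].
  pose c' : chain2 K := (c : chain2 K) - cotree_filling z.
  have extz e : e \notin bdE K -> chain_ext z e = bd2 (c : chain2 K) e.
    by move=> eb; rewrite (chain_extN _ eb) -cz bd2_chain_bar ffunE.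
  have c'0 : {in Tc, forall d, bd2 c' d = 0}.
    move=> d dTc; rewrite raddfB ffun_subE bd2_cotree_filling //.
    by rewrite extz ?subrr //; case: (cotreeP dTc).
  (* The multiple of [Xi] is read off at [f], where [xi] is 1. *)
  exists (c' f); apply/rowP => i; rewrite !mxE morse_incE.
  have := enum_valP i; rewrite EM_P => /and3P[_ eb _].
  rewrite ffun_subE extz //.
  have -> : bd2 (c : chain2 K) (enum_val i) -
      bd2 (cotree_filling z) (enum_val i) = bd2 c' (enum_val i).
    by rewrite [bd2 c']raddfB [RHS]ffun_subE.
  by rewrite (cotree_cocycle c'0) raddfMz ffun_mulrzE mulrC -(cotree_cocycle c'0).
pose c : chain2 K := Xi *~ k + cotree_filling z.
exists c; apply/eqP; rewrite eq_sym -subr_eq0; apply/eqP.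
apply: (cycle_bar_eq0 Ksimp TBtree sTB Tacyclic).
  by rewrite raddfB /= dz bd1_bd2 subr0.
move=> e eT; rewrite ffun_subE bd2_chain_bar ffunE -chain_ext_val.
rewrite raddfD raddfMz ffun_addE ffun_mulrzE -morse_incE.
(* An interior edge outside [T] lies either in [Tc], where the boundary of [Xi] vanishes, or in
   [EM T Td], where the hypothesis on the coordinates applies. *)
have [dTc|eTc] := boolP (val e \in Tc).
  rewrite bd2_cotree_filling // (_ : morse_inc _ _ _ = 0) ?mul0r ?add0r ?subrr //.
  rewrite morse_incE ffunE -[RHS](xiTc _ dTc).
  by apply: eq_bigr => x _; rewrite ffunE.
have eEM : val e \in EM T Td by rewrite EM_P eT eTc (valP e).
have := zk (enum_rank_in eEM (val e)); rewrite !mxE enum_rankK_in //.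
rewrite ffun_subE => /eqP; rewrite subr_eq => /eqP->.
by rewrite [k * _]mulrC subrr.
Qed.

Lemma tree_cycle_bar_cycle e : e \notin T -> bd1 (chain_bar (tree_cycle T e)) = 0.
Proof.
move=> eT; have [c0 _ _] := tree_cycleP Ksimp Ttree eT.
by apply/ffunP => n; rewrite bd1_chain_bar c0 ffunE big1 // => v _; rewrite ffunE.
Qed.

Lemma tree_comb_cycle (n : cell1 K -> int) :
  bd1 (\sum_(e in EM T Td) chain_bar (tree_cycle T e) *~ n e) = 0.
Proof.
rewrite raddf_sum big1 // => e; rewrite EM_P => /and3P[eT _ _].
by rewrite raddfMz /= tree_cycle_bar_cycle // mul0rz.
Qed.

(** The cycle lives on [T] and [e], so it misses [Tc] and its filling is 0. The tree cycles thus
    give the standard basis. *)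
Lemma EM_coord_tree_cycle e i : e \in EM T Td ->
  EM_coord (chain_bar (tree_cycle T e)) 0 i = (enum_val i == e)%:R.
Proof.
rewrite EM_P => /and3P[eT eb eTc].
have [_ ce c0] := tree_cycleP Ksimp Ttree eT.
have extE a : a \notin bdE K ->
    chain_ext (chain_bar (tree_cycle T e)) a = tree_cycle T e a.
  by move=> ab; rewrite (chain_extN _ ab) ffunE.
rewrite mxE ffun_subE (_ : cotree_filling _ = 0); last first.
  apply: big1 => d dTc; have [dT db] := cotreeP dTc.
  rewrite extE // c0 ?mulr0z // !inE negb_or dT andbT.
  by apply: contraNneq eTc => <-.
have := enum_valP i; rewrite EM_P => /and3P[iT ib _].
rewrite raddf0 [X in _ - X]ffunE subr0 extE //; have [->|ie] := eqVneq (enum_val i) e.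
  by rewrite ce.
by rewrite c0 // !inE negb_or ie.
Qed.

Lemma EM_coord_tree_comb (n : cell1 K -> int) :
  EM_coord (\sum_(e in EM T Td) chain_bar (tree_cycle T e) *~ n e) =
  \row_i n (enum_val i).
Proof.
pose EM_coordA : {additive chain1 (collapse K) -> 'rV[int]_#|EM T Td|} :=
  HB.pack EM_coord (GRing.isZmodMorphism.Build _ _ EM_coord EM_coord_zmod_morphism).
rewrite -[EM_coord]/(EM_coordA : _ -> _) raddf_sum; apply/rowP => i.
rewrite summxE [RHS]mxE (bigD1 (enum_val i)) ?enum_valP // big1.
  rewrite raddfMz -scaler_int mxE EM_coord_tree_cycle ?enum_valP //.
  by rewrite eqxx mulr1 intz; apply: addr0.
move=> e /andP[eEM ei]; rewrite raddfMz -scaler_int mxE EM_coord_tree_cycle //.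
by rewrite eq_sym (negPf ei) mulr0.
Qed.

Lemma EM_coord_surj w : exists z : cycle1 (collapse K), EM_coord z = w.
Proof.
pose n e := oapp (w 0) 0 [pick i | enum_val i == e :> cell1 K].
have cyc : is_cycle1 (\sum_(e in EM T Td) chain_bar (tree_cycle T e) *~ n e).
  exact/eqP/tree_comb_cycle.
exists (Cycle1 cyc); rewrite EM_coord_tree_comb; apply/rowP => i.
rewrite mxE /n; case: pickP => [j /eqP/enum_val_inj -> //|/(_ i)].
by rewrite eqxx.
Qed.

End Reduction.

(** * Cell counts and the Euler characteristic *)

Lemma vertex_card : #|cell0 K| = #|T|.+1.
Proof.
have [v _] : exists v : cell0 K, True.
  have [_ _ _ /(_ f) f3] := Ksimp.
  have /card_gt0P[e _] : (0 < #|[set e | is_side e f]|)%N by rewrite f3.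
  by have [v _] := ends_of_edge Ksimp e; exists v.
have := @forest_card _ _ _ unit (fun=> tt) (fun=> v) T
  (is_end_two_ended Ksimp (B := T)) Tacyclic.
rewrite card_unit addn1; apply=> //; first by case.
move=> x y _; case: Ttree => _ _ /(_ x y (in_setT _) (in_setT _)) [p] + _.
by case/and3P=> wp /eqP ep _; exists p.
Qed.

Lemma face_card : #|cell2 K| = #|Tc|.+1.
Proof.
have := @forest_card _ _ _ unit (fun=> tt) (fun=> f) Tc cotree_two_ended Tcacyclic.
rewrite card_unit addn1; apply=> //; first by case.
move=> x y _; case: Tctree => _ _ /(_ x y (in_setT _) (in_setT _)) [p] + _.
by case/and3P=> wp /eqP ep _; exists p.
Qed.

(** The components of the forest [T :&: bdE K] are the fibres of [to0bar]: it contains [TB], and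
    none of its edges leaves a boundary component. *)
Lemma collapsed_vertex_card : #|cell0 K| = (#|T :&: bdE K| + #|cell0bar K|)%N.
Proof.
have /boolp.choice[r rK] (n : cell0bar K) : exists v, to0bar v = n.
  by case: n => C CP; have /imsetP[v _ Cv] := CP; exists v; apply: val_inj.
apply: (forest_card (is_end_two_ended Ksimp (B := _)) _ rK).
- exact: acyclic_sub (subsetIl _ _) Tacyclic.
- move=> a x y; rewrite inE => /andP[_ ab] ax ay; apply/esym/eqP.
  rewrite -to0barE inE connect1 //; apply/exists_inP; exists a => //.
  by rewrite ax.
move=> x y /(bd_comp_walk TBtree)[p wp ep]; exists p => //.
apply: walk_sub wp; rewrite subsetI sTB; by case: TBtree.
Qed.

(** The interior edges split into those of [T], those of [Tc] and [EM T Td]. The forest counts give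
    one less than the number of collapsed vertices for the first and one less than the number of
    faces for the second. *)
Lemma EM_card : #|EM T Td|%:Z = 2 - euler_char (collapse K).
Proof.
have cI : #|cell1bar K| = #|~: bdE K|.
  by rewrite card_sig; apply: eq_card => e; rewrite [in RHS]inE.
have TI : ~: bdE K :&: T = T :\: bdE K by rewrite setIC setDE.
have TcI : (~: bdE K :\: T) :&: Tc = Tc.
  apply/setIidPr/subsetP => d /cotreeP[dT db].
  by rewrite in_setD dT in_setC.
have EMI : (~: bdE K :\: T) :\: Tc = EM T Td.
  apply/setP => e; rewrite EM_P !(in_setD, in_setC).
  by rewrite andbCA; congr andb; rewrite andbC.
have := cardsID T (~: bdE K); have := cardsID Tc (~: bdE K :\: T).
rewrite TI TcI EMI => E1 E2.
have := cardsID (bdE K) T; have := vertex_card; have := face_card.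
have := collapsed_vertex_card; rewrite /euler_char /= cI; lia.
Qed.

Lemma EM_split : EM T Td = EM_I T Td f :|: EM_II T Td f.
Proof.
apply/setP => e; rewrite [in RHS]inE [e \in EM_I _ _ _]inE [e \in EM_II _ _ _]inE.
rewrite -andb_orr; case: (boolP (e \in EM T Td)) => //=.
by rewrite EM_P => /and3P[_ /morse_inc_val + _]; rewrite !inE => ->.
Qed.

End TreeCotreeHomology.

(** * The first homology group and its torsion class *)

Theorem lemma3 (K : cwcomplex) (TB T Tc : {set cell1 K}) (f : cell2 K) :
  triangulated_surface K ->
  boundary_spanning_trees TB ->
  TB \subset T ->
  spanning_tree (@is_end K) [set: cell0 K] [set: cell1 K] T ->
  dual_spanning_tree T Tc ->
  let Td := extended_dual_tree T Tc in
  let g := #|EM T Td| in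
  let Kbar := collapse K in
  [/\ EM T Td = EM_I T Td f :|: EM_II T Td f,
      g%:Z = 2 - euler_char Kbar,
      #|EM_II T Td f| = 0%N -> zmod_isomorphic (H1 Kbar) 'rV[int]_g
    & (0 < #|EM_II T Td f|)%N ->
      zmod_isomorphic (H1 Kbar) ('rV[int]_g.-1 * 'Z_2)%type /\
      exists z : cycle1 Kbar,
        cycle1_val z = cstar T Td f /\ generates_torsion (hclass z)].
Proof.
move=> Ksurf TBtree sTB Ttree Tctree Td g Kbar.
have EMs := EM_split f Ksurf Tctree; rewrite -/Td in EMs.
have [b bP] := cotree_dual_basis Ksurf Tctree.
pose psi (z : cycle1 Kbar) := EM_coord T Tc b z.
have psiB : zmod_morphism psi by move=> z z'; apply: EM_coord_zmod_morphism.
have psi_surj w : exists z, psi z = w.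
  exact: (EM_coord_surj Ksurf Ttree Tctree b w).
have psi_bd (z : cycle1 Kbar) : is_boundary1 z <->
    exists k : int, psi z = k *: \row_i morse_inc Td f (enum_val i).
  rewrite -(EM_coord_boundary f Ksurf TBtree sTB Ttree Tctree bP).
    by split=> /boolp.asboolP.
  exact/eqP/(valP z).
split=> //; first exact: (EM_card f Ksurf TBtree sTB Ttree Tctree).
  (* All Morse incidence numbers are 0, so the single relation is trivial and the boundaries are the
     kernel of [psi]. *)
  move=> /cards0_eq II0; apply: (H1_iso psiB psi_surj) => z.
  rewrite psi_bd; split=> [->|[k ->]].
    by exists 0; rewrite scale0r.
  apply/rowP => i; rewrite !mxE; have := enum_valP i.
  by rewrite {2}EMs II0 setU0 inE => /andP[_ /eqP->]; rewrite mulr0.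
case/card_gt0P=> e0 e0II; have e0EM : e0 \in EM T Td by rewrite EMs inE e0II orbT.
(* Half of the Morse incidence number of each edge of [EM T Td]; the relation vector is then twice
   [h]. *)
pose n e := if e \in EM_II T Td f then Defs.eta Td f e else 0.
pose h : 'rV[int]_g := \row_i n (enum_val i).
have mE : \row_(i < g) morse_inc Td f (enum_val i) = 2 *: h.
  apply/rowP => i; rewrite !mxE /n; case: ifP => [|II].
    by rewrite inE /Defs.eta => /andP[_ /orP[] /eqP->].
  have := enum_valP i; rewrite {2}EMs in_setU II orbF inE => /andP[_ /eqP->].
  by rewrite mulr0.
have psi_bd2 z : is_boundary1 z <-> exists k : int, psi z = (k * 2) *: h.
  by rewrite psi_bd mE; split=> -[k ->]; exists k; rewrite scalerA.
(* An edge in [EM_II T Td f] provides the coordinate at which [h] is a sign. *)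
pose i0 := enum_rank_in e0EM e0.
have h1 : h 0 i0 * h 0 i0 = 1.
  by rewrite !mxE enum_rankK_in // /n e0II /Defs.eta; case: ifP.
split; first exact: (H1_one_relation psiB psi_surj psi_bd2 h1).
have cstarE : cstar T Td f = \sum_(e in EM T Td) chain_bar (tree_cycle T e) *~ n e.
  rewrite (bigID (mem (EM_II T Td f))) /= [X in _ + X]big1 => [|e /andP[_ /negPf II]].
    rewrite addr0; apply: eq_big => e; last by rewrite /n => ->.
    by rewrite EMs in_setU andb_orl andbb andbC; case: (e \in EM_II _ _ _); rewrite ?orbT.
  by rewrite /n II mulr0z.
have cyc : is_cycle1 (cstar T Td f).
  by rewrite cstarE; apply/eqP/tree_comb_cycle.
exists (Cycle1 cyc); split=> //.
apply: (one_relation_torsion psiB psi_bd2 h1).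
by rewrite /psi /= cstarE EM_coord_tree_comb.
Qed.
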